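(* Let $A$ be an $m\times n$ complex matrix and let $\sigma_1\ge\sigma_2\ge\cdots\ge\sigma_{\min\{m,n\}}$ be its singular values. (I) If the index $k$ satisfies $\max\{\frac m2,\frac n2\}<k\le\frac{m+n+1}{3}$, then $\phi_k(A)$ is equal to the ring $\{z\in\mathbb{C}:\sigma_{m+n-2k+1}\le|z|\le\sigma_k\}$. (II) If $k>\frac{m+n+1}{3}$, then $\phi_k(A)$ is the empty set. (III) If $k\le\max\{\frac m2,\frac n2\}$, then $\phi_k(A)$ is identified with the circular disc $\{z\in\mathbb{C}:|z|\le\sigma_k\}$.
   Context: For an $m\times n$ complex matrix $A$ and a positive integer $k\ge 1$, the rank-$k$ numerical range of $A$ is defined as $\phi_k(A)=\{z\in\mathbb{C}: PAQ=zS$ for some rank-$k$ orthogonal projections $P$ (on $\mathbb{C}^m$) and $Q$ (on $\mathbb{C}^n$), and $S=PSQ\}$. The authors assert, and use, that $z\in\phi_k(A)$ is equivalent to the existence of $M\in\mathbb{C}^{m\times k}$ and $N\in\mathbb{C}^{n\times k}$ with $M^*M=N^*N=I_k$ and $M^*AN=zI_k$ (with $P=MM^*$, $Q=NN^*$, $S=MN^*$).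
   Formalization: In (II) it is also assumed, when k≤min{m,n}, that σ_k<σ_{m+n-2k+1} (A=I_2, k=2 is a counterexample otherwise); in (III) that k≤min{m,n}, so that σ_k exists; in φ_k(A), S is a partial isometry with SS*=P and S*S=Q, i.e. S=MN*. *)

(* Defs.v *)
(* MathComp / MathComp-Analysis. *)
From mathcomp Require Export all_boot all_order all_algebra.
From mathcomp Require Export classical_sets reals.
From mathcomp Require Export complex.

Set Implicit Arguments.
Unset Strict Implicit.
Unset Printing Implicit Defensive.

Export Order.TTheory GRing.Theory Num.Theory.

Global Open Scope ring_scope.
Global Open Scope sesquilinear_scope.
Global Open Scope complex_scope.
Global Open Scope classical_set_scope.

Definition orthoproj (R : realType) (n k : nat) (P : 'M[R[i]]_n) : Prop :=
  [/\ P *m P = P, P^t* = P & \rank P = k].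

(* S is a partial isometry with final projection P and initial projection Q,
   as M N^* is when P = M M^* and Q = N N^*.  With only S = P S Q, the choice
   S = z^-1 P A Q would put every z != 0 in the set. *)
Definition rank_range (R : realType) (m n k : nat) (A : 'M[R[i]]_(m, n)) :
    set R[i] :=
  [set z | exists (P : 'M[R[i]]_m) (Q : 'M[R[i]]_n) (S : 'M[R[i]]_(m, n)),
    [/\ orthoproj k P, orthoproj k Q,
        S = P *m S *m Q, (S *m S^t* = P) /\ (S^t* *m S = Q) &
        P *m A *m Q = z *: S]].

(* Eigenvalues listed with algebraic multiplicity. *)
Definition eigenvalues (R : realType) (n : nat) (B : 'M[R[i]]_n) : seq R[i] :=
  sval (closed_field_poly_normal (char_poly B)).

(* The eigenvalues of A^* A are real and nonnegative, so that Re loses nothing.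
   There are n of them, and n - min(m, n) of the smallest ones (all zero) are
   dropped. *)
Definition singular_values (R : realType) (m n : nat) (A : 'M[R[i]]_(m, n)) :
    seq R :=
  take (minn m n)
    (sort >=%R [seq Num.sqrt (complex.Re x) | x <- eigenvalues (A^t* *m A)]).

(* 1-based: meaningful for 1 <= j <= min(m, n). *)
Definition sigma (R : realType) (m n : nat) (A : 'M[R[i]]_(m, n)) (j : nat) :
    R :=
  (singular_values A)`_j.-1.

Section Facts.
Variable R : realType.
Notation C := R[i].

Lemma adjmxM (m n p : nat) (A : 'M[C]_(m, n)) (B : 'M[C]_(n, p)) :
  (A *m B)^t* = B^t* *m A^t*.
Proof. by rewrite trmx_mul map_mxM. Qed.

Lemma adjmx1 (n : nat) : (1%:M : 'M[C]_n)^t* = 1%:M.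
Proof. by rewrite trmx1 map_mx1. Qed.

Lemma isometry_orthoproj (n k : nat) (M : 'M[C]_(n, k)) :
  M^t* *m M = 1%:M -> orthoproj k (M *m M^t*).
Proof.
move=> MM; split; last first.
- apply/eqP; rewrite eqn_leq; apply/andP; split.
    exact: leq_trans (mxrankM_maxl _ _) (rank_leq_col _).
  have E : M^t* *m (M *m M^t*) *m M = 1%:M by rewrite mulmxA MM mul1mx.
  rewrite -[leqLHS](mxrank1 C k) -E.
  exact: leq_trans (mxrankM_maxl _ _) (mxrankM_maxr _ _).
- by rewrite adjmxM trmxCK.
- by rewrite mulmxA -(mulmxA M) MM mulmx1.
Qed.

Lemma orthoproj_isometry (n k : nat) (P : 'M[C]_n) : orthoproj k P ->
  exists M : 'M[C]_(n, k), M^t* *m M = 1%:M /\ M *m M^t* = P.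
Proof.
case=> PP Ph <-; have rn := rank_leq_row P.
have uU : schmidt (row_base P) \is unitarymx by rewrite schmidt_unitarymx.
have UE : (schmidt (row_base P) :=: P)%MS.
  exact: eqmx_trans (eqmx_schmidt_free (row_base_free P)) (eq_row_base P).
set U := schmidt _ in uU UE; exists (U^t*); rewrite trmxCK.
split; first exact/unitarymxP.
have /submxP[D UD] : (U <= P)%MS by rewrite UE.
have UP : U *m P = U by rewrite UD -mulmxA PP.
have /submxP[E PE] : (P <= U)%MS by rewrite UE.
have PU : P *m U^t* *m U = P.
  by rewrite [X in X *m _ *m _]PE -(mulmxA E) (unitarymxP uU) mulmx1 -PE.
rewrite -[RHS]PU; congr (_ *m _).
by rewrite -[X in X *m _]Ph -adjmxM UP.
Qed.

(* Taking M and N with orthonormal columns, P = M M^*, Q = N N^*, S = M N^*. *)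
Lemma rank_rangeP (m n k : nat) (A : 'M[C]_(m, n)) (z : C) :
  rank_range k A z <->
  exists (M : 'M[C]_(m, k)) (N : 'M[C]_(n, k)),
    [/\ M^t* *m M = 1%:M, N^t* *m N = 1%:M & M^t* *m A *m N = z%:M].
Proof.
split=> [[P [Q [S [oP oQ SE [SS' S'S] PAQ]]]]|[M [N [MM NN MAN]]]].
  have [M [MM MP]] := orthoproj_isometry oP; exists M, (S^t* *m M).
  have [[PP Ph _] [QQ Qh _]] := (oP, oQ).
  have PM : P *m M = M by rewrite -MP -mulmxA MM mulmx1.
  have MtP : M^t* *m P = M^t* by rewrite -[P]Ph -adjmxM PM.
  have SQ : S *m Q = S by rewrite {2}SE {1}SE -mulmxA QQ.
  have QS : Q *m S^t* = S^t* by rewrite -[Q]Qh -adjmxM SQ.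
  split=> //.
    by rewrite adjmxM trmxCK mulmxA -(mulmxA _ S) SS' MtP MM.
  rewrite -QS -MtP !mulmxA -(mulmxA _ P A) -(mulmxA _ (P *m A)) PAQ.
  by rewrite -scalemxAr -!scalemxAl -(mulmxA _ S) SS' MtP MM scalemx1.
exists (M *m M^t*), (N *m N^t*), (M *m N^t*); split.
- exact: isometry_orthoproj.
- exact: isometry_orthoproj.
- by rewrite !mulmxA -(mulmxA M) MM mulmx1 -(mulmxA M) NN mulmx1.
- rewrite adjmxM trmxCK !mulmxA; split.
    by rewrite -(mulmxA M) NN mulmx1.
  by rewrite -(mulmxA N) MM mulmx1.
- by rewrite !mulmxA -2!(mulmxA M) MAN mul_mx_scalar -scalemxAl.
Qed.

(* For n >= 2, k = n exceeds (2 n + 1) / 3, yet the set is not empty: all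
   singular values of the identity coincide. *)
Lemma rank_range_id (n : nat) : rank_range n (1%:M : 'M[C]_n) 1.
Proof. by apply/rank_rangeP; exists 1%:M, 1%:M; rewrite adjmx1 !mulmx1. Qed.

End Facts.

(* Main.v *)
Require Import Defs.
From mathcomp Require Import perm ring zify.

Set Implicit Arguments.
Unset Strict Implicit.
Unset Printing Implicit Defensive.

(* Write A^* A = V diag(s_i^2) V^* with s nonincreasing.  If M^* A N = z I_k
   with isometries M and N, then |A N y| >= |z| |y| on a k-dimensional space,
   so |z| <= s_k; and the conditions that A N y lie in the range of M and that
   N y lie in the span of the first m + n - 2k + 1 columns of V leave a nonzero
   y, for which |A N y| = |z| |y|, so |z| is at least the corresponding s.

   Conversely, an isometry M with M^* B = z I exists as soon as B^* B is
   diagonal with entries >= |z|^2, at most m - k of them different from |z|^2.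
   Such a B = A N is obtained by taking for the first m - k columns of N those
   of V, and for the others combinations of one column of V with s_c >= |z| and
   one with s_p <= |z|, all these columns being distinct.  This settles every
   case but 2k <= n, where the argument applies to A^*. *)

(** * Squared norms, isometries and kernel vectors *)

Section Gram.
Variable C : numClosedFieldType.

Definition sqnorm n (x : 'cV[C]_n) : C := (x^t* *m x) 0 0.

Lemma sqnormE n (x : 'cV[C]_n) : sqnorm x = \sum_i `|x i 0| ^+ 2.
Proof. by rewrite /sqnorm mxE; apply: eq_bigr => i _; rewrite !mxE normCKC. Qed.

Lemma sqnorm_ge0 n (x : 'cV[C]_n) : 0 <= sqnorm x.
Proof. by rewrite sqnormE sumr_ge0 // => i _; rewrite exprn_ge0. Qed.

Lemma sqnorm_gt0 n (x : 'cV[C]_n) : x != 0 -> 0 < sqnorm x.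
Proof.
move=> x0; rewrite lt_def sqnorm_ge0 andbT; apply: contra x0.
rewrite sqnormE psumr_eq0 => [/allP x0|i _]; last exact: exprn_ge0.
apply/eqP/matrixP => i j; rewrite ord1 mxE; apply/eqP.
by have := x0 i (mem_index_enum i); rewrite expf_eq0 /= normr_eq0.
Qed.

Lemma sqnorm_isometry n k (N : 'M[C]_(n, k)) (y : 'cV_k) :
  N^t* *m N = 1%:M -> sqnorm (N *m y) = sqnorm y.
Proof.
by move=> NN; rewrite /sqnorm trmx_mul map_mxM mulmxA -(mulmxA _ _ N) NN mulmx1.
Qed.

Lemma sqnormZ n (a : C) (x : 'cV[C]_n) : sqnorm (a *: x) = `|a| ^+ 2 * sqnorm x.
Proof.
rewrite !sqnormE mulr_sumr; apply: eq_bigr => i _.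
by rewrite mxE normrM exprMn.
Qed.

(** The difference is the squared norm of [w - M M^* w], the component of [w] orthogonal to the
    range of [M]. *)
Lemma sqnorm_adj_le n k (M : 'M[C]_(n, k)) (w : 'cV_n) :
  M^t* *m M = 1%:M -> sqnorm (M^t* *m w) <= sqnorm w.
Proof.
move=> MM; rewrite -subr_ge0.
suff -> : sqnorm w - sqnorm (M^t* *m w) = sqnorm (w - M *m (M^t* *m w)).
  exact: sqnorm_ge0.
rewrite /sqnorm.
have -> : (w - M *m (M^t* *m w))^t* = w^t* - w^t* *m M *m M^t*.
  rewrite [(_ - _)^T]linearB /= map_mxB; congr (_ - _).
  by rewrite !trmx_mul !map_mxM trmxCK.
rewrite mulmxBl !mulmxBr !mulmxA -(mulmxA _ _ M) MM mulmx1 subrr subr0.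
by rewrite trmx_mul map_mxM trmxCK !mxE.
Qed.

Lemma exists_kernel_vector p a (K : 'M[C]_(p, a)) :
  (\rank K < a)%N -> exists2 x : 'cV_a, x != 0 & K *m x = 0.
Proof.
rewrite -mxrank_tr => rK; have : kermx K^T != 0.
  by rewrite -mxrank_eq0 mxrank_ker subn_eq0 -ltnNge.
move=> /rowV0Pn[v /sub_kermxP vK v0]; exists v^T; first by rewrite trmx_eq0.
by apply: trmx_inj; rewrite trmx_mul trmxK vK trmx0.
Qed.

(* s is indexed from 0, and its values beyond n are arbitrary as long as it
   stays nonnegative and nonincreasing. *)
Definition gram_diag m n (A : 'M[C]_(m, n)) (V : 'M_n) (s : nat -> C) : Prop :=
  [/\ V^t* *m V = 1%:M, forall i, 0 <= s i, forall i j, (i <= j)%N -> s j <= s i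
    & A^t* *m A = V *m diag_mx (\row_i s i ^+ 2) *m V^t*].

(** * Bounds from a diagonalised Gram matrix *)

Section Bounds.
Variables (m n k : nat) (A : 'M[C]_(m, n)) (V : 'M[C]_n) (s : nat -> C).
Hypothesis gramA : gram_diag A V s.

Let sqnormVE x : sqnorm x = sqnorm (V^t* *m x).
Proof.
have [VV _ _ _] := gramA; rewrite sqnorm_isometry //.
by rewrite trmxCK; exact: mulmx1C.
Qed.

Let sqnormAE x :
  sqnorm (A *m x) = \sum_(i < n) s i ^+ 2 * `|(V^t* *m x) i 0| ^+ 2.
Proof.
have [_ _ _ AA] := gramA; rewrite /sqnorm trmx_mul map_mxM mulmxA.
have xV : x^t* *m V = (V^t* *m x)^t* by rewrite trmx_mul map_mxM trmxCK.
rewrite -(mulmxA _ _ A) AA -!mulmxA (mulmxA _ V) xV.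
move: (V^t* *m x) => v; rewrite mulmxA mul_mx_diag mxE.
by apply: eq_bigr => i _; rewrite !mxE mulrAC -normCKC mulrC.
Qed.

Lemma gram_sqnorm_le p (x : 'cV_n) :
  (forall i : 'I_n, (i < p)%N -> (V^t* *m x) i 0 = 0) ->
  sqnorm (A *m x) <= s p ^+ 2 * sqnorm x.
Proof.
have [_ s0 sd _] := gramA => Vx.
rewrite sqnormAE sqnormVE sqnormE mulr_sumr ler_sum // => i _.
case: (ltnP i p) => [/Vx->|pi]; first by rewrite normr0 expr0n /= !mulr0.
by rewrite ler_wpM2r ?exprn_ge0 // lerXn2r ?qualifE //= ?s0 ?sd.
Qed.

Lemma gram_sqnorm_ge p (x : 'cV_n) :
  (forall i : 'I_n, (p < i)%N -> (V^t* *m x) i 0 = 0) ->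
  s p ^+ 2 * sqnorm x <= sqnorm (A *m x).
Proof.
have [_ s0 sd _] := gramA => Vx.
rewrite sqnormAE sqnormVE sqnormE mulr_sumr ler_sum // => i _.
case: (ltnP p i) => [/Vx->|pi]; first by rewrite normr0 expr0n /= !mulr0.
by rewrite ler_wpM2r ?exprn_ge0 // lerXn2r ?qualifE //= ?s0 ?sd.
Qed.

(** Half of the min-max principle: a [k]-dimensional space contains a nonzero vector orthogonal to
    the first [k - 1] columns of [V], and there [A] expands by at most [s k.-1]. *)
Lemma isometry_expansion_le (N : 'M[C]_(n, k)) (r : C) :
    (0 < k)%N -> 0 <= r -> N^t* *m N = 1%:M ->
    (forall y, r ^+ 2 * sqnorm y <= sqnorm (A *m (N *m y))) ->
  r <= s k.-1.
Proof.
move=> k0 r0 NN rN; have [_ s0 _ _] := gramA.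
pose K : 'M_(n, k) := pid_mx k.-1 *m (V^t* *m N).
have [|y y0 Ky] := @exists_kernel_vector _ _ K.
  apply: leq_ltn_trans (mxrankM_maxl _ _) _.
  have le_pid : (\rank (pid_mx k.-1 : 'M[C]_n) <= k.-1)%N.
    by rewrite -pid_mx_minh rank_pid_mx ?geq_minl ?geq_minr.
  by apply: leq_ltn_trans le_pid _; rewrite prednK.
have := le_trans (rN y) (gram_sqnorm_le (p := k.-1) (x := N *m y) _).
rewrite sqnorm_isometry // ler_pM2r ?sqnorm_gt0 // => H.
rewrite -(ler_pXn2r (n := 2)) ?qualifE //= ?s0 //; apply: H => i ik.
have /matrixP/(_ i 0) := Ky; rewrite -!mulmxA mxE [RHS]mxE => <-.
rewrite (bigD1 i) //= big1 => [|j ji]; last first.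
  by rewrite [pid_mx _ _ _]mxE eq_sym (inj_eq val_inj) (negPf ji) mul0r.
by rewrite [pid_mx _ _ _]mxE eqxx ik mul1r addr0.
Qed.

Lemma compression_ge (M : 'M[C]_(m, k)) (N : 'M[C]_(n, k)) (z : C) :
    (0 < k)%N -> (2 * k <= m + n)%N -> (m < 2 * k)%N ->
    M^t* *m M = 1%:M -> N^t* *m N = 1%:M -> M^t* *m A *m N = z%:M ->
  s (m + n - 2 * k) <= `|z|.
Proof.
move=> k0 kmn km MM NN MAN; have [_ s0 _ _] := gramA.
set j := (m + n - 2 * k)%N; have jn : (j.+1 <= n)%N by rewrite /j; lia.
(* Kernel vectors of K are the pairs (y, u) such that A N y = M u and the
   coordinates of N y on the columns of V of index > j vanish. *)
pose K := block_mx 1%:M 0 0 (copid_mx j.+1) *m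
          block_mx (A *m N) (- M) (V^t* *m N) (0 : 'M_(n, k)).
have [|x x0 Kx] := @exists_kernel_vector _ _ K.
  (* The left factor of [K] has rank [m + (n - j - 1) = 2k - 1], one less than the number of
     unknowns; this dictates [j]. *)
  apply: leq_ltn_trans (mxrankM_maxl _ _) _.
  by rewrite rank_diag_block_mx mxrank1 rank_copid_mx //; rewrite /j; lia.
pose y := usubmx x; pose u := dsubmx x.
move: Kx; rewrite /K mulmx_block -(vsubmxK x) -/y -/u mul_block_col.
rewrite !(mul0mx, mul1mx, mulmx0, addr0, add0r, mulNmx).
rewrite -[RHS]vsubmxK => /eq_col_mx[]; rewrite !linear0 => /eqP.
rewrite subr_eq0 => /eqP Ey Cy.
have uE : u = z *: y.
  by rewrite -[u]mul1mx -MM -mulmxA -Ey !mulmxA MAN mul_scalar_mx.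
have y0 : y != 0.
  apply: contra x0 => /eqP y0; rewrite -[x]vsubmxK -/y -/u uE y0 scaler0.
  by rewrite col_mx0.
have := gram_sqnorm_ge (p := j) (x := N *m y).
rewrite (mulmxA A) Ey !sqnorm_isometry // uE sqnormZ.
rewrite ler_pM2r ?sqnorm_gt0 // ler_pXn2r ?qualifE //=; apply => i ji.
move/eqP: Cy; rewrite /copid_mx mulmxBl mul1mx mulmxBl -!mulmxA subr_eq0.
move=> /eqP/matrixP/(_ i 0) ->; rewrite mxE big1 // => l _.
rewrite [pid_mx _ _ _]mxE; case: eqP => [_|_]; last by rewrite mul0r.
by rewrite ltnNge ji mul0r.
Qed.

End Bounds.

(** * Matrices with a diagonal Gram matrix *)

(* Gram-Schmidt makes A lower triangular up to a unitary matrix, and the order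
   of g forces this triangular factor to be diagonal: once a diagonal entry
   vanishes, so do all later rows. *)
Lemma diag_gram_factor p (A : 'M[C]_p) (g : nat -> C) :
    A *m A^t* = diag_mx (\row_i g i) ->
    (forall i j, (i <= j < p)%N -> g j <= g i) ->
  exists2 S : 'M_p, S \is unitarymx &
    exists2 t : 'rV_p, A = diag_mx t *m S & forall i, `|t 0 i| ^+ 2 = g i.
Proof.
move=> AA gd; pose S := schmidt A.
have uS : S \is unitarymx by exact: schmidt_unitarymx.
have SS : S^t* *m S = 1%:M by apply/mulmx1C/unitarymxP.
pose L := A *m S^t*.
have AE : A = L *m S by rewrite -mulmxA SS mulmx1.
have LL : L *m L^t* = diag_mx (\row_i g i).
  by rewrite -AA trmx_mul map_mxM trmxCK -!mulmxA (mulmxA _ S) SS mul1mx.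
have L_upper (i j : 'I_p) : (i < j)%N -> L i j = 0.
  move=> ij; have : (row i A <= kermx ((row j S)^t*))%MS.
    apply: submx_trans (row_schmidt_sub A i) _; apply/sumsmx_subP => l li.
    rewrite genmxE; apply/sub_kermxP/matrixP => u v; rewrite !ord1.
    have /matrixP/(_ l j) := unitarymxP uS; rewrite mxE [RHS]mxE.
    have -> : (l == j) = false by apply/eqP => lj; move: li; rewrite lj; lia.
    move=> E; rewrite [RHS]mxE -[RHS]E mxE; apply: eq_bigr => x _.
    by rewrite !mxE.
  move=> /sub_kermxP/matrixP/(_ 0 0); rewrite [RHS]mxE => <-.
  by rewrite !mxE; apply: eq_bigr => x _; rewrite !mxE.
clearbody L.
have gE (i : 'I_p) : g i = \sum_j `|L i j| ^+ 2.
  have /matrixP/(_ i i) := LL; rewrite mxE [RHS]mxE eqxx mxE mulr1n => <-.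
  by apply: eq_bigr => j _; rewrite normCK !mxE.
have L_diag (j i : 'I_p) : j != i -> L i j = 0.
  (* Strong induction on the column [j], which reduces row [j] of [L] to its diagonal entry. If this
     entry is nonzero, orthogonality of rows [i] and [j] kills [L i j]; otherwise [g j], hence
     [g i], hence row [i] vanishes. *)
  have [d] := ubnP j; elim: d j i => // d IHd j i jd ji.
  case: (ltnP i j) => [/L_upper//|ij].
  have Lj l : l != j -> L j l = 0.
    move=> lj; case: (ltnP j l) => [/L_upper//|jl]; apply: IHd => //.
    by move: lj jl jd; rewrite -(inj_eq val_inj) /=; lia.
  have [Ljj0|Ljj0] := eqVneq (L j j) 0.
    have gj : g j = 0.
      rewrite gE big1 // => l _; have [->|/Lj->] := eqVneq l j.
        by rewrite Ljj0 normr0 expr0n.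
      by rewrite normr0 expr0n.
    have : g i <= 0 by rewrite -gj; apply: gd; rewrite ij ltn_ord.
    have := gE i; rewrite (bigD1 j) //= => -> H; apply/eqP.
    rewrite -normr_eq0 -sqrf_eq0 eq_le exprn_ge0 // andbT.
    by apply: le_trans H; rewrite lerDl sumr_ge0 // => l _; rewrite exprn_ge0.
  have /matrixP/(_ i j) := LL; rewrite mxE [RHS]mxE.
  have -> : (i == j) = false by apply/eqP => E; rewrite E eqxx in ji.
  rewrite (bigD1 j) //= big1 => [|l lj]; last first.
    by rewrite !mxE Lj // rmorph0 mulr0.
  rewrite addr0 !mxE mulr0n => /eqP.
  by rewrite mulf_eq0 conjC_eq0 (negPf Ljj0) orbF => /eqP.
exists S => //; exists (\row_i L i i) => [|i].
  rewrite {1}AE; congr (_ *m _); apply/matrixP => i j; rewrite !mxE.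
  by have [->|ji] := eqVneq; rewrite ?mulr1n // mulr0n L_diag // eq_sym.
rewrite gE (bigD1 i) //= big1 ?mxE ?addr0 // => j ji.
by rewrite L_diag ?normr0 ?expr0n // eq_sym.
Qed.

(* Column c is a_c e_c + b_c e_(h c), the second term being dropped when
   h c >= n. *)
Definition pairmx n k (a b : 'I_k -> C) (h : 'I_k -> nat) : 'M[C]_(n, k) :=
  \matrix_(i, c) (a c *+ (i == c :> nat) + b c *+ (i == h c :> nat)).

(** The last hypothesis makes the supports of distinct columns disjoint. The conditions on [b]
    exclude a cross term when [h c = c] and a missing coordinate when [n <= h c]. *)
Lemma pairmx_gram n k (a b : 'I_k -> C) (h : 'I_k -> nat) (l : nat -> C) :
    (k <= n)%N ->
    (forall c, h c = c -> b c = 0) -> (forall c, (n <= h c)%N -> b c = 0) ->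
    (forall c d, c != d -> h c <> d /\ h c <> h d) ->
  (pairmx n a b h)^t* *m diag_mx (\row_i l i) *m pairmx n a b h =
  diag_mx (\row_c (`|a c| ^+ 2 * l c + `|b c| ^+ 2 * l (h c))).
Proof.
move=> kn hb hn hd; apply/matrixP => c d; rewrite mul_mx_diag !mxE.
have [<-|cd] := eqVneq c d; last first.
  rewrite mulr0n big1 // => i _; rewrite !mxE.
  have [hcd hh] := hd _ _ cd; rewrite eq_sym in cd; have [hdc _] := hd _ _ cd.
  have [ic|_] := eqVneq (i : nat) c.
    have -> : (i == d :> nat) = false.
      by rewrite ic (inj_eq val_inj) eq_sym (negPf cd).
    have -> : (i == h d :> nat) = false by apply/eqP; lia.
    by rewrite !mulr0n addr0 mulr0.
  have [ih|_] := eqVneq (i : nat) (h c).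
    have -> : (i == d :> nat) = false by apply/eqP; lia.
    have -> : (i == h d :> nat) = false by apply/eqP; lia.
    by rewrite !mulr0n addr0 mulr0.
  by rewrite !mulr0n addr0 rmorph0 !mul0r.
transitivity (\sum_(i < n) ((if i == c :> nat then `|a c| ^+ 2 * l i else 0)
                     + (if i == h c :> nat then `|b c| ^+ 2 * l i else 0))).
  apply: eq_bigr => i _; rewrite !mxE mulrAC -normCKC.
  have [ic|_] := eqVneq (i : nat) c; have [ih|_] := eqVneq (i : nat) (h c).
  - by rewrite (hb c) -?ih ?normr0 ?expr0n ?mul0r ?mul0rn ?addr0.
  - by rewrite mulr0n !addr0.
  - by rewrite mulr0n !add0r.
  - by rewrite !mulr0n !addr0 normr0 expr0n mul0r.
rewrite big_split /= -!big_mkcond /= (big_ord1_eq _ (fun i => _ * l i)).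
rewrite (big_ord1_eq _ (fun i => `|b c| ^+ 2 * l i)).
rewrite (leq_trans (ltn_ord c) kn) mulr1n; case: ltnP => // /hn->.
by rewrite normr0 expr0n mul0r.
Qed.

(** Zero rows make [B^*] square and continue [g] by zeros, which stays nonincreasing because [g] is
    nonnegative. *)
Lemma orthogonal_columns_factor k q (B : 'M[C]_(k + q, k)) (g : nat -> C) :
    B^t* *m B = diag_mx (\row_c g c) ->
    (forall i j, (i <= j < k)%N -> g j <= g i) ->
    (forall c, (c < k)%N -> 0 <= g c) ->
  exists2 S : 'M_(k + q), S \is unitarymx &
    exists2 t : 'rV_k, B^t* *m S^t* = row_mx (diag_mx t) 0
                     & forall c, `|t 0 c| ^+ 2 = g c.
Proof.
move=> BB gd g0; pose A0 : 'M[C]_(k + q) := col_mx (B^t*) 0.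
pose g' i : C := if (i < k)%N then g i else 0.
have [||S uS [t AS tg]] := @diag_gram_factor _ A0 g'.
- rewrite /A0 tr_col_mx map_row_mx mul_col_row trmxCK BB.
  rewrite trmx0 map_mx0 !mul0mx mulmx0; apply/matrixP => i j.
  rewrite -(splitK i) -(splitK j).
  case: (split i) => {}i; case: (split j) => {}j /=.
  + by rewrite block_mxEul !mxE /g' /= ltn_ord (inj_eq (@lshift_inj _ _)).
  + by rewrite block_mxEur !mxE eq_lrshift mulr0n.
  + by rewrite block_mxEdl !mxE eq_rlshift mulr0n.
  + by rewrite block_mxEdr !mxE /g' /= ltnNge leq_addr mul0rn.
- move=> i j /andP[ij _]; rewrite /g'; case: (ltnP j k) => jk.
    by rewrite (leq_ltn_trans ij jk) gd ?ij.
  by case: ltnP => // ik; apply: g0.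
exists S => //; exists (lsubmx t) => [|c]; last first.
  by rewrite mxE tg /g' /= ltn_ord.
have -> : B^t* *m S^t* = usubmx (diag_mx t).
  by rewrite -[diag_mx t](mulmxtVK _ uS) -AS /A0 mul_col_mx col_mxKu.
by rewrite -{1}[t]hsubmxK diag_mx_row /block_mx col_mxKu.
Qed.

(** A coefficient of modulus [|z| / sqrt (g c) <= 1] on [e_c] is completed to a unit vector along
    [e_(k + c)]. That coordinate exists only for [c < q], so the other columns need modulus exactly
    1. *)
Lemma diag_gram_fill k q (B : 'M[C]_(k + q, k)) (g : nat -> C) (z : C) :
    B^t* *m B = diag_mx (\row_c g c) ->
    (forall i j, (i <= j < k)%N -> g j <= g i) ->
    (forall c, (c < k)%N -> `|z| ^+ 2 <= g c) ->
    (forall c, (q <= c < k)%N -> g c = `|z| ^+ 2) ->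
  exists2 M : 'M_(k + q, k), M^t* *m M = 1%:M & M^t* *m B = z%:M.
Proof.
move=> BB gd zg gz.
have [c ck|S uS [t BS tg]] := orthogonal_columns_factor BB gd.
  by apply: le_trans (zg _ ck); exact: exprn_ge0.
pose tc c := t 0 c; have tcg c : `|tc c| ^+ 2 = g c by exact: tg.
(* In the coordinates given by S, B is diag(t)^* stacked on 0; column c of M is
   a_c e_c + b_c e_(k + c), with t_c a_c = z^*. *)
pose a c := if tc c == 0 then 1 else (z^*)%R / tc c.
pose b (c : 'I_k) := if (q <= c)%N then 0 else sqrtC (1 - `|a c| ^+ 2).
have at_ c : tc c * a c = (z^*)%R.
  rewrite /a; case: eqVneq => [t0|t0]; last by rewrite mulrC divfK.
  have := zg c (ltn_ord c); rewrite -tcg t0 normr0 expr0n /= => z0.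
  suff /eqP -> : z == 0 by rewrite rmorph0 mul0r.
  by rewrite -normr_eq0 -sqrf_eq0 eq_le z0 exprn_ge0.
have a2 c : tc c != 0 -> `|a c| ^+ 2 = `|z| ^+ 2 / g c.
  move=> t0; rewrite /a (negPf t0) normrM normfV norm_conjC exprMn exprVn.
  by rewrite tcg.
have ab c : `|a c| ^+ 2 + `|b c| ^+ 2 = 1.
  have [t0|t0] := eqVneq (tc c) 0.
    rewrite /b /a t0 eqxx normr1 expr1n subrr sqrtC0 if_same.
    by rewrite normr0 expr0n addr0.
  have g0 : 0 < g c by rewrite -tcg exprn_gt0 // normr_gt0.
  rewrite /b; case: leqP => qc.
    rewrite normr0 expr0n addr0 a2 // gz ?qc ?ltn_ord // divff //.
    by rewrite -(gz c) ?qc ?ltn_ord // gt_eqF.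
  rewrite -[`|sqrtC _| ^+ 2]normrX sqrtCK [`|1 - _|]ger0_norm.
    by rewrite addrC subrK.
  by rewrite a2 // subr_ge0 ler_pdivrMr // mul1r zg.
pose X := pairmx (k + q) a b (fun c => k + c)%N.
have XX : X^t* *m X = 1%:M.
  have := @pairmx_gram (k + q) k a b (fun c => k + c)%N (fun=> 1).
  have -> : \row_(i < k + q) 1 = const_mx 1 :> 'rV[C]_(k + q).
    by apply/rowP => i; rewrite !mxE.
  rewrite diag_const_mx mulmx1 => ->.
  - rewrite -diag_const_mx; congr diag_mx; apply/rowP => c.
    by rewrite !mxE !mulr1 ab.
  - exact: leq_addr.
  - by move=> c; have := ltn_ord c; lia.
  - by move=> c; rewrite leq_add2l /b => ->.
  - move=> c d cd; have := ltn_ord d; have : (c : nat) <> d by apply/eqP.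
    lia.
exists (S^t* *m X).
  rewrite trmx_mul map_mxM trmxCK !mulmxA -(mulmxA _ S).
  by rewrite (unitarymxP uS) mulmx1.
rewrite -[LHS]trmxCK trmx_mul map_mxM trmxCK mulmxA BS.
suff -> : row_mx (diag_mx t) 0 *m X = ((z^*)%R)%:M.
  by rewrite tr_scalar_mx map_scalar_mx /= conjCK.
rewrite -[X]vsubmxK mul_row_col mul0mx addr0.
apply/matrixP => c d; rewrite mul_diag_mx !mxE /= (inj_eq val_inj).
have -> : ((c : nat) == k + d)%N = false.
  by apply/eqP; have := ltn_ord c; lia.
rewrite mulr0n addr0; have [->|] := eqVneq c d; last by rewrite !mulr0n mulr0.
by rewrite !mulr1n at_.
Qed.

(** * Construction of compressions from paired columns of [V] *)

Lemma gram_pair_columns k m n (A : 'M[C]_(m, n)) V (s : nat -> C)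
    (a b : 'I_k -> C) (h : 'I_k -> nat) (N := V *m pairmx n a b h) :
    gram_diag A V s -> (k <= n)%N ->
    (forall c, `|a c| ^+ 2 + `|b c| ^+ 2 = 1) ->
    (forall c, h c = c -> b c = 0) -> (forall c, (n <= h c)%N -> b c = 0) ->
    (forall c d, c != d -> h c <> d /\ h c <> h d) ->
  N^t* *m N = 1%:M /\
  (A *m N)^t* *m (A *m N) =
    diag_mx (\row_c (`|a c| ^+ 2 * s c ^+ 2 + `|b c| ^+ 2 * s (h c) ^+ 2)).
Proof.
move=> [VV _ _ AA] kn ab hb hn hd.
have N0P l := @pairmx_gram n k a b h l kn hb hn hd.
split.
  rewrite /N trmx_mul map_mxM mulmxA -(mulmxA _ _ V) VV mulmx1.
  have := N0P (fun=> 1).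
  have -> : \row_(i < n) 1 = const_mx 1 :> 'rV[C]_n.
    by apply/rowP => i; rewrite !mxE.
  rewrite diag_const_mx mulmx1 => ->.
  rewrite -diag_const_mx; congr diag_mx; apply/rowP => c.
  by rewrite !mxE !mulr1.
rewrite /N trmx_mul map_mxM mulmxA -(mulmxA _ _ A) AA.
rewrite trmx_mul map_mxM !mulmxA -(mulmxA _ _ V) VV mulmx1.
by rewrite -(mulmxA _ _ V) VV mulmx1 (N0P (fun i => s i ^+ 2)).
Qed.

(** Carries the bound [|z| <= s k.-1] over to the adjoint: [A^*] expands by at least [s k.-1] on the
    span of the first [k] left singular vectors of [A]. *)
Lemma gram_adj_le k m n (A : 'M[C]_(m, n)) V W (s u : nat -> C) :
    gram_diag A V s -> gram_diag (A^t*) W u -> (0 < k)%N ->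
    (k <= m)%N -> (k <= n)%N ->
  s k.-1 <= u k.-1.
Proof.
move=> gA gA' k0 km kn; have [q mE] : exists q, m = (k + q)%N.
  by exists (m - k)%N; lia.
subst m; have [_ s0 sd _] := gA.
have l_le i j : (i <= j)%N -> s j ^+ 2 <= s i ^+ 2.
  by move=> ij; rewrite lerXn2r ?qualifE //= ?s0 ?sd.
have [] := @gram_pair_columns k _ n A V s (fun=> 1) (fun=> 0)
  (fun c => n + c)%N gA kn => //.
- by move=> c; rewrite normr1 normr0 expr1n expr0n addr0.
- move=> c d cd; have := ltn_ord d; have : (c : nat) <> d by apply/eqP.
  by split; lia.
set N := V *m _ => NN BB.
have [|||S uS [t BS tg]] := @orthogonal_columns_factor k q (A *m N)
    (fun i => s i ^+ 2).
- rewrite BB; congr diag_mx; apply/rowP => c.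
  by rewrite !mxE normr1 normr0 expr1n expr0n mul1r mul0r addr0.
- by move=> i j /andP[ij _]; apply: l_le.
- by move=> c _; apply: exprn_ge0.
(* [N] is made of the first [k] columns of [V], and [Y] is chosen so that [A N = Y diag(t)^*]. *)
have SS := unitarymxP uS; pose Y : 'M[C]_(k + q, k) := S^t* *m col_mx 1%:M 0.
apply: (isometry_expansion_le (N := Y) gA') => // [|y].
  rewrite trmx_mul map_mxM trmxCK !mulmxA -(mulmxA _ S) SS mulmx1.
  rewrite tr_col_mx map_row_mx mul_row_col trmx0 map_mx0 mul0mx addr0.
  by rewrite trmx1 map_mx1 mulmx1.
apply: le_trans (sqnorm_adj_le _ NN).
have -> : N^t* *m (A^t* *m (Y *m y)) = diag_mx t *m y.
  rewrite !mulmxA -map_mxM -trmx_mul BS mul_row_col mul0mx addr0.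
  by rewrite mulmx1.
rewrite !sqnormE mulr_sumr ler_sum // => i _.
rewrite mul_diag_mx mxE normrM exprMn tg ler_wpM2r ?exprn_ge0 //.
by apply: l_le; have := ltn_ord i; lia.
Qed.

(** Apart from the case [x = y], the weights are [(r - y) / (x - y)] and [(x - r) / (x - y)]. The
    last clause serves a column that is its own partner. *)
Lemma convex_weights (x y r : C) : y <= r -> r <= x ->
  exists ab : C * C, [/\ `|ab.1| ^+ 2 + `|ab.2| ^+ 2 = 1,
    `|ab.1| ^+ 2 * x + `|ab.2| ^+ 2 * y = r & x = y -> ab.2 = 0].
Proof.
move=> yr rx; have [xy|xy] := eqVneq x y.
  exists (1, 0) => /=; rewrite normr1 normr0 expr1n expr0n.
  rewrite addr0 mul1r mul0r addr0.
  by split=> //; apply/eqP; rewrite eq_le rx xy yr.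
have xy0 : 0 < x - y by rewrite subr_gt0 lt_neqAle eq_sym xy (le_trans yr).
have xyN := lt0r_neq0 xy0.
have sq (w : C) : 0 <= w -> `|sqrtC w| ^+ 2 = w.
  by move=> w0; rewrite -normrX sqrtCK ger0_norm.
exists (sqrtC ((r - y) / (x - y)), sqrtC ((x - r) / (x - y))) => /=.
rewrite !sq ?divr_ge0 ?subr_ge0 ?(ltW xy0) //; try exact: le_trans yr rx.
split; [by field | by field | by move=> E; rewrite E eqxx in xy].
Qed.

Lemma compression_exists k m n (A : 'M[C]_(m, n)) V s (z : C) :
    gram_diag A V s -> (0 < k)%N -> (k <= m)%N -> (k <= n)%N ->
    (3 * k <= m + n + 1)%N ->
    `|z| <= s k.-1 -> ((m < 2 * k)%N -> s (m + n - 2 * k)%N <= `|z|) ->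
  exists (M : 'M_(m, k)) (N : 'M_(n, k)),
    [/\ M^t* *m M = 1%:M, N^t* *m N = 1%:M & M^t* *m A *m N = z%:M].
Proof.
move=> gA k0 km kn kq zs; have [q mE] : exists q, m = (k + q)%N.
  by exists (m - k)%N; lia.
subst m => sz; have [_ s0 sd _] := gA.
(* For c >= q, column c of V is paired with column h c, so that the last column
   k - 1 gets the partner m + n - 2k; for c < q, h c is out of range. *)
pose l i := s i ^+ 2; pose h (c : 'I_k) := ((n + q).-1 - c)%N.
have ld i j : (i <= j)%N -> l j <= l i.
  by move=> ij; rewrite /l lerXn2r ?qualifE //= ?s0 ?sd.
pose g i := if (i < q)%N then l i else `|z| ^+ 2.
have zl c : (c < k)%N -> `|z| ^+ 2 <= l c.
  move=> ck; apply: le_trans (ld c k.-1 _); last by lia.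
  by rewrite /l lerXn2r ?qualifE //= ?s0.
have /fin_all_exists[ab abP] (c : 'I_k) : exists ab : C * C,
  [/\ `|ab.1| ^+ 2 + `|ab.2| ^+ 2 = 1,
     `|ab.1| ^+ 2 * l c + `|ab.2| ^+ 2 * l (h c) = g c,
      h c = c -> ab.2 = 0 & (n <= h c)%N -> ab.2 = 0].
  have ck := ltn_ord c; rewrite /g; case: ltnP => qc.
    exists (1, 0) => /=; rewrite normr1 normr0 expr1n expr0n.
    by rewrite addr0 mul1r mul0r addr0.
  have [||ab [ab1 abz abN]] := @convex_weights (l c) (l (h c)) (`|z| ^+ 2).
  (* [c < k] gives [h c >= m + n - 2k], and [q <= c < k] supplies the premise [m < 2k] of [sz]. *)
  - apply: le_trans (ld (k + q + n - 2 * k)%N _ _) _; first by rewrite /h; lia.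
    by rewrite /l lerXn2r ?qualifE //= ?s0 ?sz //; lia.
  - exact: zl.
  by exists ab; split=> // [hc|]; [apply: abN; rewrite hc | rewrite /h; lia].
have [] := @gram_pair_columns k _ n A V s (fun c => (ab c).1)
  (fun c => (ab c).2) h gA kn; try by move=> c; case: (abP c).
  (* [h c = d] would mean [c + d = m + n - k - 1], at least [2k - 2] by [3k <= m + n + 1], whereas
     distinct [c, d < k] have [c + d <= 2k - 3]. *)
  move=> c d cd; have := ltn_ord d; have := ltn_ord c.
  by have : (c : nat) <> d by [apply/eqP]; rewrite /h; lia.
set N := V *m _ => NN BB.
have {}BB : (A *m N)^t* *m (A *m N) = diag_mx (\row_c g c).
  by rewrite BB; congr diag_mx; apply/rowP => c; rewrite !mxE; case: (abP c).
have [|||M MM MB] := @diag_gram_fill k q _ g z BB.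
- move=> i j /andP[ij jk]; rewrite /g; case: (ltnP j q) => jq.
    by rewrite (leq_ltn_trans ij jq) ld.
  by case: ifP => // _; apply: zl; exact: leq_ltn_trans jk.
- by move=> c ck; rewrite /g; case: ifP => // _; apply: zl.
- by move=> c /andP[qc _]; rewrite /g ltnNge qc.
by exists M, N; rewrite -mulmxA.
Qed.

End Gram.

(** * Singular values and the spectral theorem *)

Lemma char_poly_conj (F : comUnitRingType) n (P Q D : 'M[F]_n) :
  P *m Q = 1%:M -> char_poly (P *m D *m Q) = char_poly D.
Proof.
move=> PQ; have QP := mulmx1C PQ; rewrite /char_poly.
have -> : char_poly_mx (P *m D *m Q) =
    map_mx polyC P *m char_poly_mx D *m map_mx polyC Q.
  rewrite /char_poly_mx mulmxBr mulmxBl !map_mxM scalar_mxC.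
  rewrite -(mulmxA _ (map_mx _ P)) -[map_mx _ P *m _]map_mxM.
  by rewrite PQ map_mx1 mulmx1.
rewrite !det_mulmx mulrAC -det_mulmx -map_mxM PQ map_mx1 det1.
by rewrite mul1r.
Qed.

Lemma perm_eigenvalues (R : realType) n (B D : 'M[R[i]]_n) :
    is_trig_mx D -> char_poly B = char_poly D ->
  perm_eq (eigenvalues B) [seq D i i | i <- enum 'I_n].
Proof.
move=> tD BD; apply: prod_XsubC_eq; rewrite big_map big_enum /=.
rewrite -char_poly_trig // -BD /eigenvalues; case: closed_field_poly_normal.
by move=> e /= E; rewrite [RHS]E (monicP (char_poly_monic _)) scale1r.
Qed.

(** The spectral theorem lists the eigenvalues in some order; the permutation that sorts their
    square roots is applied to the columns of the diagonalising matrix. *)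
Lemma gram_diag_sigma (R : realType) m n (A : 'M[R[i]]_(m, n)) :
  exists V s, gram_diag A V s /\
    forall j, (0 < j <= minn m n)%N -> s j.-1 = (sigma A j)%:C.
Proof.
pose G := A^t* *m A; pose P := spectralmx G; pose d := spectral_diag G.
have uP : P \is unitarymx := spectral_unitarymx G.
have PP : P *m P^t* = 1%:M := unitarymxP uP.
have PP' : P^t* *m P = 1%:M := mulmx1C PP.
have GE : G = P^t* *m diag_mx d *m P.
  rewrite -(invmx_unitary uP); apply/orthomx_spectralP/normalmxP.
  by rewrite trmx_mul map_mxM trmxCK.
have d0 i : 0 <= d 0 i.
  have /matrixP/(_ i i) : (A *m P^t*)^t* *m (A *m P^t*) = diag_mx d.
    rewrite trmx_mul map_mxM trmxCK mulmxA -(mulmxA P) -/G GE !mulmxA.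
    by rewrite PP mul1mx -mulmxA PP mulmx1.
  rewrite [RHS]mxE eqxx mulr1n mxE => <-; apply: sumr_ge0 => x _.
  by rewrite !mxE mulrC mul_conjC_ge0.
have eP : perm_eq (eigenvalues G) [seq d 0 i | i <- enum 'I_n].
  have -> : [seq d 0 i | i <- enum 'I_n] = [seq diag_mx d i i | i <- enum 'I_n].
    by apply: eq_map => i; rewrite mxE eqxx.
  apply: perm_eigenvalues (diag_mx_is_trig _) _.
  by rewrite GE char_poly_conj.
pose r i := Num.sqrt (complex.Re (d 0 i)).
pose t := [tuple r i | i < n].
pose ss := sort >=%R [seq Num.sqrt (complex.Re x) | x <- eigenvalues G].
have /tuple_permP[p ssE] : perm_eq ss t.
  rewrite perm_sort; apply: perm_trans (perm_map _ eP) _.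
  by rewrite -map_comp.
have size_ss : size ss = n by rewrite ssE size_tuple.
have ss_nth (i : 'I_n) : ss`_i = r (p i).
  by rewrite ssE -tnth_nth !tnth_mktuple.
(* Beyond [n], the default value 0 of [nth] keeps the sequence nonnegative and nonincreasing. *)
have ss0 i : 0 <= ss`_i.
  case: (ltnP i n) => [lt_in|?]; last by rewrite nth_default ?size_ss.
  by rewrite (ss_nth (Ordinal lt_in)) sqrtr_ge0.
have ssd i j : (i <= j)%N -> ss`_j <= ss`_i.
  move=> ij; case: (ltnP j n) => jn; last by rewrite nth_default ?size_ss.
  have ss_sorted : sorted >=%R ss by apply: sort_sorted => x y; exact: le_total.
  apply: (sorted_leq_nth _ _ 0 ss_sorted) => //; rewrite ?inE ?size_ss //.
  - by move=> x y w /= yx wy; apply: le_trans wy yx.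
  - by move=> x /=.
  - exact: leq_ltn_trans jn.
pose V := col_perm p (P^t*).
exists V, (fun i => (ss`_i)%:C); split; last first.
  by move=> j jmn; rewrite /sigma /singular_values nth_take //; lia.
split=> [|i|i j ij|].
- apply/matrixP => i j; have /matrixP/(_ (p i) (p j)) := PP.
  rewrite [X in _ = X -> _]mxE (inj_eq perm_inj) => E; rewrite [RHS]mxE -E.
  by rewrite !mxE; apply: eq_bigr => x _; rewrite !mxE conjCK.
- by rewrite ler0c.
- by rewrite lecR ssd.
- rewrite -/G GE; apply/matrixP => x y; rewrite 2!mul_mx_diag mxE [RHS]mxE.
  rewrite (reindex_inj (@perm_inj _ p)); apply: eq_bigr => i _.
  rewrite !mxE conjCK; congr (_ * _ * _).
  rewrite ss_nth -rmorphXn /= sqr_sqrtr.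
    by rewrite RRe_real // realE d0.
  by have := d0 (p i); rewrite lecE => /andP[].
Qed.

(** * Constraints on compressions, and the three cases *)

Section Compressions.
Variables (C : numClosedFieldType) (m n k : nat).

Lemma isometry_leq (M : 'M[C]_(m, k)) : M^t* *m M = 1%:M -> (k <= m)%N.
Proof.
move=> MM; rewrite -[leqLHS](mxrank1 C k) -MM.
exact: leq_trans (mxrankM_maxr _ _) (rank_leq_row _).
Qed.

(** [M^*] is a contraction, so [|z| |y| = |M^* A N y| <= |A N y|]. *)
Lemma compression_le (A : 'M[C]_(m, n)) V s (M : 'M[C]_(m, k)) N (z : C) :
    gram_diag A V s -> (0 < k)%N -> M^t* *m M = 1%:M -> N^t* *m N = 1%:M ->
    M^t* *m A *m N = z%:M ->
  `|z| <= s k.-1.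
Proof.
move=> gA k0 MM NN MAN; apply: (isometry_expansion_le gA k0 _ NN) => // y.
rewrite -sqnormZ -mul_scalar_mx -MAN -!mulmxA; exact: sqnorm_adj_le.
Qed.

End Compressions.

Theorem proposition14 (R : realType) (m n : nat) (A : 'M[R[i]]_(m, n))
    (k : nat) (k_gt0 : (0 < k)%N) :
  [/\ (maxn m n < 2 * k)%N -> (3 * k <= m + n + 1)%N ->
        rank_range k A =
        [set z : R[i] | (sigma A (m + n - 2 * k + 1))%:C <= `|z|
                        /\ `|z| <= (sigma A k)%:C],
      (m + n + 1 < 3 * k)%N ->
        ((k <= minn m n)%N -> sigma A k < sigma A (m + n - 2 * k + 1)) ->
        rank_range k A = set0 &
      (2 * k <= maxn m n)%N -> (k <= minn m n)%N ->
        rank_range k A = [set z : R[i] | `|z| <= (sigma A k)%:C]].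
Proof.
have [V [s [gA sE]]] := gram_diag_sigma A.
have sk : (k <= minn m n)%N -> (sigma A k)%:C = s k.-1.
  by move=> kmn; rewrite sE // k_gt0.
(* The strict bounds on [k] say that [m + n - 2k + 1 <= min(m, n)], so that [sigma] is meaningful
   there. *)
have sj : (k <= minn m n)%N -> (m < 2 * k)%N -> (n < 2 * k)%N ->
    (sigma A (m + n - 2 * k + 1))%:C = s (m + n - 2 * k)%N.
  by move=> kmn km kn; rewrite addn1 -sE //; lia.
split=> [kmn k3|k3 s_lt|k2 kmn]; apply/seteqP; split=> z /=.
- move=> /rank_rangeP[M [N [MM NN MAN]]].
  have [km kn] := (isometry_leq MM, isometry_leq NN).
  rewrite sk ?sj; [|lia..]; split.
    by apply: (compression_ge gA) MAN => //; lia.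
  exact: (compression_le gA k_gt0 MM NN MAN).
- rewrite sk ?sj; [|lia..] => -[sz zs]; apply/rank_rangeP.
  by apply: (compression_exists gA) => //; lia.
- move=> /rank_rangeP[M [N [MM NN MAN]]].
  have [km kn] := (isometry_leq MM, isometry_leq NN).
  (* Together with [3k > m + n + 1] this gives [m, n < 2k], so both bounds on [|z|] apply, in
     contradictory order. *)
  have kmn : (k <= minn m n)%N by lia.
  have := s_lt kmn; rewrite -ltcR sk ?sj //; [|lia..].
  move=> /(le_lt_trans (compression_le gA k_gt0 MM NN MAN)) /lt_geF/negP; case.
  by apply: (compression_ge gA) MAN => //; lia.
- by [].
- move=> /rank_rangeP[M [N [MM NN MAN]]].
  by rewrite sk //; exact: (compression_le gA k_gt0 MM NN MAN).
rewrite sk // => zs; apply/rank_rangeP.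
(* If [2k <= m], the lower bound on [|z|] is vacuous. Otherwise [2k <= n], and the adjoint of a
   compression of [A^*] to the conjugate of [z] is taken. *)
have [km|km] := leqP (2 * k) m.
  by apply: (compression_exists gA) => //; lia.
have [W [u [gA' _]]] := gram_diag_sigma (A^t*).
have su : s k.-1 <= u k.-1 by apply: gram_adj_le gA gA' _ _ _; lia.
have zu : `|Num.conj z| <= u k.-1 by rewrite norm_conjC (le_trans zs su).
have [||||M [N [MM NN MAN]]] := compression_exists gA' k_gt0 _ _ _ zu.
1-4: by lia.
exists N, M; split=> //.
have := congr1 (fun X => X^t*) MAN.
rewrite tr_scalar_mx map_scalar_mx /= conjCK.
by rewrite !trmx_mul !map_mxM !trmxCK mulmxA.
Qed.
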